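(* Let $a>1$ be an integer, let $p$ be a prime, let $K \ge 1$ be an integer, and let $N = 2Kp+1$. Suppose that $2K \le p$ and $2K < \log_a(2Kp+1)$. Then $N$ is prime if and only if $a^{N-1} \equiv 1 \pmod N$. *)

(* Defs.v *)
From mathcomp Require Import all_boot all_order all_algebra.
From mathcomp Require Import reals exp.

Set Implicit Arguments.
Unset Strict Implicit.
Unset Printing Implicit Defensive.

Local Open Scope ring_scope.

(* [ln] is only meaningful for positive arguments, so [logb b x] is the
   logarithm to base [b] when [0 < b], [b != 1] and [0 < x]. *)
Definition logb (R : realType) (b x : R) : R := ln x / ln b.

(* Main.v *)
Require Import Defs.
From mathcomp Require Import all_boot all_order all_algebra all_solvable.
From mathcomp Require Import reals exp.

Import Order.TTheory GRing.Theory Num.Theory.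

(** If [a ^ (N - 1) = 1] modulo [N], the order of [a] divides [2 * K * p] but
    not [2 * K], since [1 < a ^ (2 * K) < N].  Hence [p] divides the order of
    [a], so it divides [totient N]; as [p] does not divide [N], some prime
    factor [q] of [N] is [1] modulo [p].  The cofactor [N / q] is then also [1]
    modulo [p], and if it were not [1] we would get
    [N >= (p + 1) ^ 2 > 2 * K * p + 1]. *)

Lemma expn_eq1_mod_dvdn (a m n N : nat) : m %| n ->
  a ^ m = 1 %[mod N] -> a ^ n = 1 %[mod N].
Proof.
by case/dvdnP=> k -> am1; rewrite mulnC expnM -modnXm am1 modnXm exp1n.
Qed.

(** Bezout over [nat] gives [u * m = v * n + gcdn m n]; both [a ^ (u * m)] and [a ^ (v * n)] are 1
    modulo [N]. *)
Lemma expn_gcdn_eq1_mod (a m n N : nat) : 0 < m ->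
  a ^ m = 1 %[mod N] -> a ^ n = 1 %[mod N] -> a ^ gcdn m n = 1 %[mod N].
Proof.
move=> m_gt0 am1 an1; case: (egcdnP n m_gt0) => u v def_um _.
have := expn_eq1_mod_dvdn _ _ _ _ (dvdn_mull u (dvdnn m)) am1.
have := expn_eq1_mod_dvdn _ _ _ _ (dvdn_mull v (dvdnn n)) an1.
by rewrite def_um expnD -modnMml => ->; rewrite modnMml mul1n.
Qed.

(** [totient N] is a product of factors [q.-1 * q ^ e] over the primes [q] dividing [N]; if [p]
    divided [q ^ e], then [p = q] would divide [N]. *)
Lemma prime_dvdn_totient (p N : nat) : prime p -> 0 < N ->
  p %| totient N -> ~~ (p %| N) ->
  exists q, [/\ prime q, q %| N & p %| q.-1].
Proof.
move=> p_pr N_gt0 p_tot pN; move: p_tot.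
rewrite totientE // Euclid_dvd_prod // big_has_cond => /hasP[q].
rewrite mem_primes => /and3P[q_pr _ qN] /=.
rewrite Euclid_dvdM // => /orP[pq1 | ]; first by exists q.
rewrite Euclid_dvdX // dvdn_prime2 // => /andP[/eqP def_p _].
by rewrite def_p qN in pN.
Qed.

Lemma expn_lt_of_lt_logb (R : realType) (a m n : nat) : 1 < a -> 0 < n ->
  (m%:R < logb (a%:R : R) n%:R)%R -> a ^ m < n.
Proof.
move=> a_gt1 n_gt0; have a_gt0 := ltnW a_gt1.
rewrite /logb ltr_pdivlMr ?ln_gt0 ?ltr1n // mulr_natl -lnXn ?ltr0n //.
by rewrite ltr_ln ?posrE ?exprn_gt0 ?ltr0n // -natrX ltr_nat.
Qed.

Theorem corollary2p4 (R : realType) (a p K N : nat)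
    (ha : (1 < a)%N) (hp : prime p) (hK : (1 <= K)%N)
    (hN : N = (2 * K * p + 1)%N)
    (hKp : (2 * K <= p)%N)
    (hlog : ((2 * K)%:R < logb (a%:R : R) (2 * K * p + 1)%:R)%R) :
  prime N <-> a ^ (N - 1) = 1 %[mod N].
Proof.
have p_gt1 := prime_gt1 hp.
have N1 : N - 1 = 2 * K * p by rewrite hN addnK.
have N_gt0 : 0 < N by rewrite hN addn1.
have a2K_ltN : a ^ (2 * K) < N.
  by rewrite hN; apply: (@expn_lt_of_lt_logb R) hlog; rewrite ?addn1.
have a2K_gt1 : 1 < a ^ (2 * K) by rewrite -(expn0 a) ltn_exp2l ?muln_gt0.
have N_gt1 : 1 < N := ltn_trans a2K_gt1 a2K_ltN.
split=> [N_pr | aN1].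
  have a_ltN : a < N.
    by apply: leq_ltn_trans a2K_ltN; rewrite -{1}(expn1 a) leq_exp2l ?muln_gt0.
  (* Fermat: the prime [N] exceeds [a], hence is coprime to it. *)
  rewrite subn1 -totient_prime //; apply: Euler_exp_totient.
  rewrite coprime_sym prime_coprime // gtnNdvd // ltnW //.
have co_aN : coprime a N.
  have N1_gt0 : 0 < N - 1 by rewrite subn_gt0.
  by rewrite -(coprime_pexpl _ _ N1_gt0) /coprime -gcdn_modl aN1 gcdn_modl gcd1n.
(* [gcdn (N - 1) (totient N)] stands in for the order of [a]: were [p] coprime to [totient N], it
   would divide [2 * K], forcing [a ^ (2 * K) = 1]. *)
have p_tot : p %| totient N.
  apply: contraLR a2K_gt1; rewrite -prime_coprime // => co_p.
  have gcd_2K : gcdn (N - 1) (totient N) %| 2 * K.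
    rewrite -(@Gauss_dvdl _ _ p); last first.
      by rewrite coprime_sym (coprime_dvdr (dvdn_gcdr _ _)).
    by rewrite -N1 dvdn_gcdl.
  have a2K_eq1 : a ^ (2 * K) = 1 %[mod N].
    apply: (expn_eq1_mod_dvdn _ _ _ _ gcd_2K).
    apply: expn_gcdn_eq1_mod => //; first by rewrite subn_gt0.
    exact: Euler_exp_totient.
  by move: a2K_eq1; rewrite !modn_small // => ->.
have pN : ~~ (p %| N).
  by rewrite hN dvdn_addr ?dvdn_mull // dvdn1 gtn_eqF.
have [q [q_pr /dvdnP[m def_N] /dvdnP[k def_q1]]] :=
  prime_dvdn_totient p N hp N_gt0 p_tot pN.
have def_q : q = k * p + 1 by rewrite -def_q1 addn1 prednK ?prime_gt0.
have m_gt0 : 0 < m by case: (m) def_N N_gt0 => // ->.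
have p_m1 : p %| m.-1.
  (* Expand [N = m * (k * p + 1)] and cancel 1. *)
  have def_Np : 2 * K * p = m * k * p + m.-1.
    apply: (@addIn 1).
    by rewrite -hN def_N def_q mulnDr mulnA muln1 -addnA addn1 prednK.
  by rewrite -(dvdn_addr _ (dvdn_mull (m * k) (dvdnn p))) -def_Np dvdn_mull.
case: (leqP m 1) => [m_le1 | m_gt1].
  by have /eqP m1 : m == 1; [rewrite eqn_leq m_le1 | rewrite def_N m1 mul1n].
have m_gtp : p < m by rewrite -(prednK m_gt0) ltnS dvdn_leq // -ltnS prednK.
have q_gtp : p < q.
  rewrite -(prednK (prime_gt0 q_pr)) ltnS dvdn_leq ?def_q1 ?dvdn_mull //.
  by rewrite -def_q1 -ltnS prednK ?prime_gt1 ?prime_gt0.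
(* [m * q = N], and [2 * K <= p] bounds [N] by [p * p + 1]; the inequality would force
   [p + p = 0]. *)
have : p.+1 * p.+1 <= p * p + 1.
  apply: leq_trans (leq_mul m_gtp q_gtp) _.
  by rewrite -def_N hN leq_add2r leq_mul2r hKp orbT.
by rewrite mulSn mulnS addnA addnC leq_add2l addSn ltnS leqn0 addn_eq0
  gtn_eqF // ltnW.
Qed.
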